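(* For every $\varepsilon>0$ there exists $c>0$ such that the following holds. Let $G$ be a graph on $n$ vertices of average degree $d$ and maximum degree $\Delta\leq d(1+\varepsilon/2)$ such that $d\leq n(1/2-\varepsilon)$. Then $$\mathrm{pdisc}(G)\geq c\,d^{1/4}n.$$
   Context: Let $G$ have vertex set $\{1,\dots,n\}$ and adjacency matrix $A$; $J$ is the $n\times n$ all-ones matrix and $\langle X,Y\rangle=\sum_{i,j}X_{i,j}Y_{i,j}$. For a real symmetric $n\times n$ matrix $X$, $\mathrm{disc}(X)=\langle X,A-\frac dnJ\rangle$, and $\mathrm{pdisc}(G)$ is the maximum of $\mathrm{disc}(X)$ over all positive semidefinite real symmetric $X$ with $X_{i,i}\leq 1$ for all $i$. *)

(* Defs.v *)
From HB Require Import structures.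
From mathcomp Require Import all_boot all_order all_algebra.
From mathcomp Require Import ring lra.
From mathcomp Require Import all_classical all_reals all_analysis.

Set Implicit Arguments.
Unset Strict Implicit.
Unset Printing Implicit Defensive.

Import Order.TTheory GRing.Theory Num.Theory.
Import numFieldNormedType.Exports.

Local Open Scope classical_set_scope.
Local Open Scope ring_scope.

Record sgraph (n : nat) := SGraph {
  edge :> rel 'I_n;
  edge_sym : symmetric edge;
  edge_irr : irreflexive edge
}.

Definition deg n (G : sgraph n) (i : 'I_n) : nat := #|[pred j | G i j]|.

Definition maxdeg n (G : sgraph n) : nat := (\max_(i < n) deg G i)%N.

(* For n = 0 this is 0 / 0 = 0. *)
Definition avgdeg (R : realType) n (G : sgraph n) : R :=
  (\sum_(i < n) deg G i)%N%:R / n%:R.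

Definition adjmx (R : realType) n (G : sgraph n) : 'M[R]_n :=
  \matrix_(i, j) (G i j)%:R.

Definition mxinner (R : realType) n (X Y : 'M[R]_n) : R :=
  \sum_i \sum_j X i j * Y i j.

Definition psdmx (R : realType) n (X : 'M[R]_n) : Prop :=
  X^T = X /\ forall v : 'cV[R]_n, 0 <= (v^T *m X *m v) ord0 ord0.

Definition disc (R : realType) n (G : sgraph n) (X : 'M[R]_n) : R :=
  mxinner X (adjmx R G - (avgdeg R G / n%:R) *: const_mx 1).

Definition pdisc_feasible (R : realType) n : set 'M[R]_n :=
  [set X | psdmx X /\ forall i, X i i <= 1].

(* The maximum is written as a supremum; pdisc_attained and disc_le_pdisc show
   that it is one. *)
Definition pdisc (R : realType) n (G : sgraph n) : R :=
  sup [set disc G X | X in @pdisc_feasible R n].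

Lemma pdisc_feasible_le1 (R : realType) n (X : 'M[R]_n) :
  pdisc_feasible X -> forall i j, `|X i j| <= 1.
Proof.
move=> [[sX pX] dX] i j.
have quad (s : R) : 0 <= X i i + s * (X i j + X j i) + s ^+ 2 * X j j.
  have := pX (delta_mx i ord0 + s *: delta_mx j ord0).
  have -> : (delta_mx i ord0 + s *: delta_mx j ord0)^T =
            delta_mx ord0 i + s *: delta_mx ord0 j :> 'rV[R]_n.
    apply/matrixP => a b.
    by rewrite !mxE [(b == i) && _]andbC [(b == j) && _]andbC.
  rewrite mulmxDl -scalemxAl -!rowE mulmxDr -scalemxAr -!colE !mxE.
  by congr (0 <= _); ring.
have eX : X j i = X i j by rewrite -[in LHS]sX mxE.
have := quad 1; have := quad (-1).
rewrite eX => h1 h2.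
have di := dX i; have dj := dX j.
by rewrite ler_norml; apply/andP; split; lra.
Qed.

Lemma vec_mx_continuous (R : realType) n (i j : 'I_n) :
  continuous (fun v : 'rV[R]_(n * n) => vec_mx v i j).
Proof.
rewrite (_ : (fun v => _) = fun v : 'rV[R]_(n * n) => v ord0 (mxvec_index i j)).
  exact: coord_continuous.
by apply/funext => v; rewrite mxE.
Qed.

Lemma mxinner_continuous (R : realType) n (Y : 'M[R]_n) :
  continuous (fun v : 'rV[R]_(n * n) => mxinner (vec_mx v) Y).
Proof.
apply: continuous_big => [x|i _]; first exact: add_continuous.
apply: continuous_big => [x|j _]; first exact: add_continuous.
move=> v; apply: continuousM; [exact: vec_mx_continuous|exact: cst_continuous].
Qed.

Lemma quad_mxinner (R : realType) n (X : 'M[R]_n) (v : 'cV[R]_n) :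
  (v^T *m X *m v) ord0 ord0 = mxinner X (v *m v^T).
Proof.
rewrite /mxinner exchange_big mxE; apply: eq_bigr => j _.
rewrite mxE mulr_suml; apply: eq_bigr => i _.
by rewrite !mxE big_ord1 !mxE mulrAC mulrC.
Qed.

Lemma pdisc_feasible_compact (R : realType) n :
  compact [set v : 'rV[R]_(n * n) | pdisc_feasible (vec_mx v)].
Proof.
apply: bounded_closed_compact.
  exists 1; split=> // M M1 v fv.
  rewrite /Num.norm /= mx_normrE; apply/bigmax_leP; split.
    exact: le_trans ler01 (ltW M1).
  move=> [a k] _ /=; rewrite (ord1 a).
  case/mxvec_indexP: k => i j; rewrite -[v]vec_mxK mxvecE.
  exact: le_trans (pdisc_feasible_le1 fv _ _) (ltW M1).
have cl (Y : 'M[R]_n) (A : set R) : closed A ->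
    closed [set v : 'rV[R]_(n * n) | A (mxinner (vec_mx v) Y)].
  by move=> cA; have /continuous_closedP := @mxinner_continuous R n Y; apply.
have -> : [set v : 'rV[R]_(n * n) | pdisc_feasible (vec_mx v)] =
  (\bigcap_i \bigcap_j [set v : 'rV[R]_(n * n) |
      [set 0] (vec_mx v j i - vec_mx v i j)]) `&`
  (\bigcap_(w in [set: 'cV[R]_n]) [set v : 'rV[R]_(n * n) |
      mxinner (vec_mx v) (w *m w^T) >= 0]) `&`
  \bigcap_i [set v : 'rV[R]_(n * n) | vec_mx v i i <= 1].
  apply/seteqP; split=> v /=.
    move=> [[sX pX] dX]; split; last by move=> i _; exact: dX.
    split; last by move=> w _ /=; rewrite -quad_mxinner.
    by move=> i _ j _ /=; rewrite -{1}sX mxE subrr.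
  move=> [[sX pX] dX]; split; last by move=> i; exact: dX.
  split; last by move=> w; rewrite quad_mxinner; exact: pX.
  apply/matrixP => i j; apply/eqP; rewrite mxE -subr_eq0; apply/eqP.
  exact: sX.
apply: closedI; first apply: closedI.
+ apply: closed_bigI => i _; apply: closed_bigI => j _.
  apply: (iffLR (continuous_closedP _)); last exact: closed_eq.
  by move=> v; apply: continuousB; exact: vec_mx_continuous.
+ by apply: closed_bigI => w _; exact: (cl _ _ (@closed_ge R 0)).
+ apply: closed_bigI => i _.
  exact: (iffLR (continuous_closedP _) (@vec_mx_continuous R n i i) _
            (@closed_le R 1)).
Qed.

Lemma disc_max (R : realType) n (G : sgraph n) :
  exists2 X : 'M[R]_n, pdisc_feasible X &
    forall Y, pdisc_feasible Y -> disc G Y <= disc G X.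
Proof.
have ne : [set v : 'rV[R]_(n * n) | pdisc_feasible (vec_mx v)] !=set0.
  exists 0; split=> /=; last by move=> i; rewrite !mxE ler01.
  by rewrite linear0; split=> [|w]; rewrite ?trmx0 // mulmx0 mul0mx mxE.
have [|v] := EVT_max_rV ne (@pdisc_feasible_compact R n)
    (f := fun v => disc G (vec_mx v)).
  by apply: continuous_subspaceT; exact: mxinner_continuous.
rewrite inE => fv vmax; exists (vec_mx v) => // Y fY.
by have := vmax (mxvec Y); rewrite inE /= mxvecK; apply.
Qed.

Lemma disc_le_pdisc (R : realType) n (G : sgraph n) (X : 'M[R]_n) :
  pdisc_feasible X -> disc G X <= pdisc R G.
Proof.
move=> fX; have [Z fZ Zmax] := disc_max R G.
apply: ub_le_sup; last by exists X.
by exists (disc G Z) => _ [Y fY <-]; exact: Zmax.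
Qed.

Lemma pdisc_attained (R : realType) n (G : sgraph n) :
  exists2 X : 'M[R]_n, pdisc_feasible X & disc G X = pdisc R G.
Proof.
have [Z fZ Zmax] := disc_max R G; exists Z => //.
apply/eqP; rewrite eq_le disc_le_pdisc //=.
apply: ge_sup; first by exists (disc G Z), Z.
by move=> _ [Y fY <-]; exact: Zmax.
Qed.

(* Main.v *)
Require Import Defs.
From mathcomp Require Import all_boot all_order all_algebra.
From mathcomp Require Import ring lra.
From mathcomp Require Import all_classical all_reals all_analysis.

Set Implicit Arguments.
Unset Strict Implicit.
Unset Printing Implicit Defensive.

Import Order.TTheory GRing.Theory Num.Theory.
Local Open Scope ring_scope.

(* Write B = A - (d/n) J and p = pdisc(G). The first-order conditions at an
   optimum of the semidefinite program yield a diagonal matrix D of trace p with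
   N = D - B positive semidefinite. By the Schur product theorem the entrywise
   square of N is positive semidefinite, and off the diagonal it equals the
   square of B; pairing it with B gives roughly the sum of the B_ij^3, which is
   nd (1 - q)(1 - 2q) with q = d/n, hence at least eps n d. The rows where
   N_ii > K, with K of order (p + d) / (eps n), are few and are discarded; this
   is harmless because the maximum degree is O(d). After division by K^2 the
   matrix is feasible, so (p + d)^3 is at least a constant times n^3 d.
   The test matrix (A + Delta I) / Delta gives p >= eps n, which absorbs d into p
   and settles d <= 1; for d >= 1 one has d^(1/4) <= d^(1/3). *)

(** * Positive semidefinite matrices: Schur complements and Schur products *)

Section PositiveSemidefinite.
Context {R : realType} {n : nat}.
Implicit Types (M N X : 'M[R]_n) (u : 'I_n -> R).

Lemma psdmxP X :
  psdmx X <-> (forall i j, X i j = X j i) /\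
              (forall u, 0 <= \sum_i \sum_j X i j * (u i * u j)).
Proof.
have quadE (v : 'cV[R]_n) : (v^T *m X *m v) ord0 ord0 =
    \sum_i \sum_j X i j * (v i ord0 * v j ord0).
  rewrite quad_mxinner /mxinner; apply: eq_bigr => i _; apply: eq_bigr => j _.
  by rewrite !mxE big_ord1 !mxE.
split=> -[sX pX]; split.
- by move=> i j; rewrite -{1}sX mxE.
- move=> u; have := pX (\col_i u i); rewrite quadE.
  by under eq_bigr do under eq_bigr do rewrite !mxE.
- by apply/matrixP => i j; rewrite mxE.
- by move=> v; rewrite quadE.
Qed.

Lemma psdmx_diag_ge0 X i : psdmx X -> 0 <= X i i.
Proof.
move=> /psdmxP[_ /(_ (fun j => (j == i)%:R))].
rewrite (bigD1 i) //= [X in _ + X]big1 ?addr0 => [|k /negPf ki]; last first.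
  by rewrite big1 // => j _; rewrite ki mul0r mulr0.
rewrite (bigD1 i) //= [X in _ + X]big1 ?addr0 => [|k /negPf ki]; last first.
  by rewrite ki !mulr0.
by rewrite eqxx !mulr1.
Qed.

(** The right side is the quadratic form at [u + t e_i], a polynomial in [t]; suitable choices of
    [t] give the next two lemmas. *)
Lemma psdmx_shift X i u (t : R) : psdmx X ->
  0 <= \sum_a \sum_b X a b * (u a * u b) + t * (\sum_b X i b * u b) *+ 2
       + t ^+ 2 * X i i.
Proof.
move=> /psdmxP[sX pX]; apply: le_trans (pX (fun j => u j + t * (j == i)%:R)) _.
have row a : \sum_b X a b * ((u a + t * (a == i)%:R) * (u b + t * (b == i)%:R))
    = \sum_b X a b * (u a * u b) + t * (X a i * u a)
      + (a == i)%:R * (t * (\sum_b X a b * u b) + t ^+ 2 * X a i).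
  have -> : X a i = \sum_b X a b * (b == i)%:R.
    rewrite (bigD1 i) //= big1 ?addr0 ?eqxx ?mulr1 // => b /negPf ->.
    by rewrite mulr0.
  rewrite mulr_suml !mulr_sumr -!big_split mulr_sumr -big_split /=.
  by apply: eq_bigr => b _; ring.
rewrite (eq_bigr _ (fun a _ => row a)) !big_split /= -mulr_sumr.
have -> : \sum_b X b i * u b = \sum_b X i b * u b.
  by apply: eq_bigr => b _; rewrite sX.
rewrite [X in _ + X](bigD1 i) //= [X in _ + (_ + X)]big1 => [|a /negPf ->];
  last by rewrite mul0r.
rewrite eqxx mul1r.
by rewrite le_eqVlt; apply/predU1P; left; ring.
Qed.

Lemma psdmx_diag0 X i j : psdmx X -> X i i = 0 -> X i j = 0.
Proof.
move=> pX Xii0; have [//|nz] := eqVneq (X i j) 0.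
(* Since [X i i = 0], the form at [e_j + t e_i] is affine in [t] with slope [2 X i j]; this [t]
   gives it the value [- X j j - 2 < 0]. *)
have := psdmx_shift i (fun b => (b == j)%:R) (- (X j j + 1) / X i j) pX.
have dlt (F : 'I_n -> R) : \sum_b F b * (b == j)%:R = F j.
  rewrite (bigD1 j) //= big1 ?addr0 ?eqxx ?mulr1 // => b /negPf ->.
  by rewrite mulr0.
under eq_bigr => a _.
  under eq_bigr do rewrite mulrA.
  rewrite dlt; over.
rewrite !dlt Xii0 mulr0 addr0 divfK // => h.
by have := psdmx_diag_ge0 j pX; lra.
Qed.

(** The form of the Schur complement at [u] is the minimum over [t] of the form of [X] at
    [u + t e_k]. *)
Lemma psdmx_schur_complement X k : psdmx X -> 0 < X k k ->
  psdmx (\matrix_(i, j) (X i j - X k i * X k j / X k k)).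
Proof.
move=> pX Xk; have /psdmxP[sX _] := pX; apply/psdmxP; split=> [i j|u].
  by rewrite !mxE (sX i j) [X k i * _]mulrC.
have := psdmx_shift k u (- (\sum_b X k b * u b) / X k k) pX.
set s := \sum_b X k b * u b.
have -> : \sum_i \sum_j (\matrix_(i, j) (X i j - X k i * X k j / X k k)) i j
      * (u i * u j) = \sum_a \sum_b X a b * (u a * u b) - s * s / X k k.
  rewrite /s big_distrlr /= mulr_suml -sumrB; apply: eq_bigr => i _.
  rewrite mulr_suml -sumrB.
  by apply: eq_bigr => j _; rewrite mxE; ring.
congr (_ <= _); rewrite -addrA; congr (_ + _); field.
exact: lt0r_neq0.
Qed.

(* Subtracting the rank-one matrix of a nonzero row kills that row and keeps
   the matrix positive semidefinite, so the number of nonzero diagonal entries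
   decreases. *)
Lemma mxinner_psd_ge0 M N : psdmx M -> psdmx N -> 0 <= mxinner M N.
Proof.
move=> + pN; have /psdmxP[_ qN] := pN.
have [m] := ubnP #|[pred i | M i i != 0]|; elim: m M => // m IH M lem pM.
have [k Mk|M0] := pickP (fun i => M i i != 0); last first.
  rewrite /mxinner big1 // => i _; rewrite big1 // => j _.
  by rewrite (psdmx_diag0 _ pM) ?mul0r //; apply/eqP/negbFE/M0.
have Mk0 : 0 < M k k by rewrite lt_neqAle eq_sym Mk psdmx_diag_ge0.
have pM' := psdmx_schur_complement pM Mk0.
set M' := \matrix_(_, _) _ in pM'.
have -> : mxinner M N =
    mxinner M' N + (M k k)^-1 * \sum_i \sum_j N i j * (M k i * M k j).
  rewrite /mxinner mulr_sumr -big_split; apply: eq_bigr => i _ /=.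
  rewrite mulr_sumr -big_split; apply: eq_bigr => j _ /=.
  by rewrite mxE; ring.
apply: addr_ge0; last by rewrite mulr_ge0 ?invr_ge0 ?(ltW Mk0).
apply: IH => //; rewrite -ltnS; apply: leq_trans lem.
rewrite ltnS; apply: proper_card; apply/fintype.properP; split.
  apply/fintype.subsetP => i; rewrite !inE; apply: contraNneq => Mi0.
  have /psdmxP[sM _] := pM.
  by rewrite mxE (sM k i) (psdmx_diag0 k pM Mi0) Mi0 !mul0r subr0.
by exists k; rewrite !inE // mxE mulfK // subrr eqxx.
Qed.

Lemma psdmx_congr_diag M u :
  psdmx M -> psdmx (\matrix_(i, j) (u i * u j * M i j)).
Proof.
move=> /psdmxP[sM pM]; apply/psdmxP; split=> [i j|v].
  by rewrite !mxE sM [u i * _]mulrC.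
apply: le_trans (pM (fun i => u i * v i)) _; rewrite le_eqVlt; apply/predU1P.
left; apply: eq_bigr => i _; apply: eq_bigr => j _; rewrite mxE; ring.
Qed.

(** The form of the entrywise product at [u] is the inner product of [diag(u) M diag(u)] with
    [N]. *)
Lemma psdmx_schur_product M N :
  psdmx M -> psdmx N -> psdmx (\matrix_(i, j) (M i j * N i j)).
Proof.
move=> pM pN; have [/psdmxP[sM _] /psdmxP[sN _]] := (pM, pN).
apply/psdmxP; split=> [i j|u]; first by rewrite !mxE sM sN.
apply: le_trans (mxinner_psd_ge0 (psdmx_congr_diag u pM) pN) _.
rewrite le_eqVlt; apply/predU1P; left.
by apply: eq_bigr => i _; apply: eq_bigr => j _; rewrite !mxE; ring.
Qed.

Lemma psdmxZ (a : R) M : 0 <= a -> psdmx M -> psdmx (a *: M).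
Proof.
move=> a0 [sM pM]; split; first by rewrite linearZ /= sM.
by move=> v; rewrite -scalemxAr -scalemxAl mxE mulr_ge0.
Qed.

End PositiveSemidefinite.

(** * First-order optimality in the semidefinite program *)

Lemma mxinnerZl (R : realType) n (a : R) (X Y : 'M[R]_n) :
  mxinner (a *: X) Y = a * mxinner X Y.
Proof.
rewrite /mxinner mulr_sumr; apply: eq_bigr => i _; rewrite mulr_sumr.
by apply: eq_bigr => j _; rewrite mxE mulrA.
Qed.

Lemma linear_coef_le0 (R : realType) (a b c t0 : R) : 0 < t0 ->
  (forall t, 0 < t -> t <= t0 -> a * t + b * t ^+ 2 + c * t ^+ 3 <= 0) ->
  a <= 0.
Proof.
move=> t0_gt0 h; rewrite leNgt; apply/negP => a0.
set e := `|b| + `|c| + 1.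
have e0 : 0 < e by rewrite ltr_wpDl // addr_ge0.
(* As [t <= 1], the higher terms divided by [t] are at least [- t e >= - a / 2], so the polynomial
   would be positive at [t]. *)
set t := Num.min t0 (Num.min 1 (a / (2 * e))).
have t_gt0 : 0 < t by rewrite !lt_min t0_gt0 ltr01 divr_gt0 // mulr_gt0.
have t1 : t <= 1 by rewrite !ge_min lexx orbT.
have te : t * (2 * e) <= a.
  by rewrite -ler_pdivlMr ?mulr_gt0 // !ge_min lexx !orbT.
have tt0 : t <= t0 by rewrite ge_min lexx.
have := h t t_gt0 tt0.
have -> : a * t + b * t ^+ 2 + c * t ^+ 3 = t * (a + t * (b + t * c)) by ring.
rewrite pmulr_rle0 // => {}h.
have tc : - `|c| <= t * c.
  by rewrite lerNl -mulrN (le_trans (ler_norm _)) // normrM normrN gtr0_norm //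
     ler_piMl.
have tb : t * - e <= t * (b + t * c).
  rewrite ler_pM2l //; have := ler_norm (- b); rewrite normrN /e; lra.
nra.
Qed.

(* At an optimum X the perturbation X -> S (X + t v v^T) S with
   S = diag(1 - t v_i^2 / 2) stays feasible, and D - B being positive
   semidefinite is the resulting first-order condition, where D_i = (X B)_ii. *)
Lemma pdisc_dual (R : realType) n (G : sgraph n) :
  let B := adjmx R G - (avgdeg R G / n%:R) *: const_mx 1 in
  exists2 D : 'I_n -> R, \sum_i D i = pdisc R G &
    psdmx (\matrix_(i, j) ((i == j)%:R * D i - B i j)).
Proof.
move=> B; have [X fX dX] := pdisc_attained R G.
have [pX X1] := fX; have /psdmxP[sX qX] := pX.
have sB i j : B i j = B j i by rewrite !mxE edge_sym.
exists (fun i => \sum_j X i j * B i j); first by rewrite -dX.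
apply/psdmxP; split=> [i j|v].
  rewrite [LHS]mxE [RHS]mxE (sB j i) (eq_sym j i).
  by case: eqVneq => [->|_]; rewrite ?mul0r.
(* [p1], and [p2], [p3] below, are the coefficients of [t], [t^2], [t^3] in the change of [disc]
   under the perturbation. *)
set p1 := \sum_i \sum_j (v i * v j - X i j * (v i ^+ 2 + v j ^+ 2) / 2) * B i j.
have p1E : p1 = - \sum_i \sum_j
    (\matrix_(i, j) ((i == j)%:R * (\sum_j X i j * B i j) - B i j)) i j
      * (v i * v j).
  have sw : \sum_i \sum_j X i j * v j ^+ 2 * B i j
      = \sum_i \sum_j X i j * v i ^+ 2 * B i j.
    rewrite exchange_big; apply: eq_bigr => j _; apply: eq_bigr => i _ /=.
    by rewrite sX sB.
  have dg i : \sum_j (i == j)%:R * (\sum_k X i k * B i k) * (v i * v j)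
      = \sum_j X i j * v i ^+ 2 * B i j.
    rewrite (bigD1 i) //= [X in _ + X]big1 => [|j /negPf ji]; last first.
      by rewrite eq_sym ji !mul0r.
    rewrite eqxx mul1r addr0 mulr_suml; apply: eq_bigr => j _; ring.
  have -> : p1 = \sum_i \sum_j B i j * (v i * v j)
      - (\sum_i \sum_j X i j * v i ^+ 2 * B i j
         + \sum_i \sum_j X i j * v j ^+ 2 * B i j) / 2.
    rewrite -big_split mulr_suml -sumrB; apply: eq_bigr => i _ /=.
    rewrite -big_split mulr_suml -sumrB.
    by apply: eq_bigr => j _ /=; field.
  have half (x : R) : (x + x) / 2 = x by field.
  rewrite sw half -opprB; congr (- _).
  rewrite -sumrB; apply: eq_bigr => i _; rewrite -dg -sumrB.
  by apply: eq_bigr => j _; rewrite mxE; ring.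
rewrite -oppr_le0 -p1E.
set V := \sum_i v i ^+ 2.
have V0 : 0 <= V by apply: sumr_ge0 => i _; exact: sqr_ge0.
have vV i : v i ^+ 2 <= V.
  by rewrite /V (bigD1 i) //= lerDl sumr_ge0 // => j _; exact: sqr_ge0.
set p2 := \sum_i \sum_j (X i j * v i ^+ 2 * v j ^+ 2 / 4
  - v i * v j * (v i ^+ 2 + v j ^+ 2) / 2) * B i j.
set p3 := \sum_i \sum_j (v i * v j * v i ^+ 2 * v j ^+ 2 / 4) * B i j.
(* This range of [t] ensures [t v_i^2 <= 1] for all [i]; the [+ 1] covers [v = 0]. *)
apply: (@linear_coef_le0 _ p1 p2 p3 (V + 1)^-1).
  by rewrite invr_gt0; lra.
move=> t t0; rewrite -[_^-1]mul1r ler_pdivlMr; last by lra.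
move=> tV.
pose s i := 1 - t * v i ^+ 2 / 2.
pose Y := \matrix_(i, j) (s i * s j * (X + t *: \matrix_(i, j) (v i * v j)) i j).
have fY : pdisc_feasible Y.
  split.
    apply: psdmx_congr_diag; apply/psdmxP; split=> [i j|u].
      by rewrite !mxE sX [v i * _]mulrC.
    have -> : \sum_i \sum_j (X + t *: (\matrix_(i, j) (v i * v j))) i j
        * (u i * u j) = \sum_i \sum_j X i j * (u i * u j)
          + t * (\sum_i v i * u i) ^+ 2.
      rewrite expr2 mulr_suml mulr_sumr -big_split; apply: eq_bigr => i _ /=.
      rewrite !mulr_sumr -big_split; apply: eq_bigr => j _ /=.
      by rewrite !mxE; ring.
    by rewrite addr_ge0 // mulr_ge0 ?sqr_ge0 // ltW.
  move=> i; rewrite !mxE -expr2.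
  have := X1 i; have := vV i; have := sqr_ge0 (v i); rewrite /s -expr2.
  set y := v i ^+ 2; set x := X i i => y0 yV x1.
  have ty0 : 0 <= t * y by rewrite mulr_ge0 // ltW.
  have ty1 : t * y <= 1 by nra.
  move: (t * y) ty0 ty1 => z z0 z1.
  (* The right side equals [1 - 3 z^2 / 4 + z^3 / 4], at most 1 on [[0, 1]]. *)
  have : (1 - z / 2) ^+ 2 * (x + z) <= (1 - z / 2) ^+ 2 * (1 + z).
    by rewrite ler_wpM2l ?sqr_ge0 // lerD2r.
  by nra.
have := disc_le_pdisc G fY; rewrite -dX -subr_le0; congr (_ <= _).
rewrite /disc /mxinner -/B -sumrB /p1 /p2 /p3 !mulr_suml -!big_split.
apply: eq_bigr => i _ /=; rewrite -sumrB !mulr_suml -!big_split.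
apply: eq_bigr => j _ /=.
have -> : Y i j = s i * s j * (X i j + t * (v i * v j)) by rewrite !mxE.
by rewrite /s; field.
Qed.

(** * Lower bounds on [pdisc] from test matrices *)

Section Graph.
Context {R : realType} {n : nat} (G : sgraph n).
Local Notation d := (avgdeg R G).
Local Notation q := (d / n%:R).

Lemma adj_row_sum i : \sum_j (G i j)%:R = (deg G i)%:R :> R.
Proof.
rewrite /deg -sum1_card natr_sum [RHS]big_mkcond; apply: eq_bigr => j _.
by rewrite inE; case: (G i j).
Qed.

Lemma deg_le_maxdeg i : (deg G i <= maxdeg G)%N.
Proof. exact: (@leq_bigmax _ (deg G) i). Qed.

Lemma avgdeg_ge0 : 0 <= d.
Proof. by rewrite divr_ge0. Qed.

Lemma sum_deg : (0 < n)%N -> \sum_i (deg G i)%:R = n%:R * d.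
Proof.
by move=> n0; rewrite mulrC /avgdeg divfK ?natr_sum // pnatr_eq0 -lt0n.
Qed.

Lemma pdisc_ge0 : 0 <= pdisc R G.
Proof.
have /(disc_le_pdisc G) : pdisc_feasible (0 : 'M[R]_n).
  split=> [|i]; last by rewrite mxE.
  by apply/psdmxP; split=> [i j|u]; rewrite ?mxE // sumr_ge0 // => i _;
    rewrite sumr_ge0 // => j _; rewrite mxE mul0r.
by rewrite /disc /mxinner big1 // => i _; rewrite big1 // => j _;
  rewrite mxE mul0r.
Qed.

(* Test matrix: (A + Delta I) / Delta. *)
Lemma pdisc_ge_maxdeg : (0 < n)%N ->
  d * (n%:R - d - (maxdeg G)%:R) <= (maxdeg G)%:R * pdisc R G.
Proof.
move=> n0; set m := (maxdeg G)%:R.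
have nz : n%:R != 0 :> R by rewrite pnatr_eq0 -lt0n.
have m_ge0 : 0 <= m by exact: ler0n.
have degm i : (deg G i)%:R <= m by rewrite ler_nat deg_le_maxdeg.
pose Y : 'M[R]_n := \matrix_(i, j) ((G i j)%:R + m * (i == j)%:R).
have dY : mxinner Y (adjmx R G - q *: const_mx 1) = d * (n%:R - d - m).
  have row i : \sum_j Y i j * (adjmx R G - q *: const_mx 1) i j =
      (deg G i)%:R * (1 - q) - m * q.
    have -> : m * q = \sum_j (j == i)%:R * (m * q).
      by rewrite (bigD1 i) //= eqxx mul1r big1 ?addr0 // => j /negPf ->;
        rewrite mul0r.
    rewrite -adj_row_sum mulr_suml -sumrB; apply: eq_bigr => j _.
    rewrite !mxE (eq_sym j i); case: eqVneq => [<-|_].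
      by rewrite edge_irr /=; ring.
    by case: (G i j) => /=; ring.
  rewrite /mxinner (eq_bigr _ (fun i _ => row i)) sumrB -mulr_suml sum_deg //.
  by rewrite sumr_const card_ord -[_ *+ n]mulr_natr; field.
have pY : psdmx Y.
  apply/psdmxP; split=> [i j|u]; first by rewrite !mxE edge_sym eq_sym.
  have -> : \sum_i \sum_j Y i j * (u i * u j) =
      \sum_i \sum_j (G i j)%:R * (u i * u j) + \sum_i m * u i ^+ 2.
    rewrite -big_split; apply: eq_bigr => i _ /=.
    have -> : m * u i ^+ 2 = \sum_j (j == i)%:R * (m * u i * u j).
      rewrite (bigD1 i) //= eqxx mul1r big1 ?addr0; first by ring.
      by move=> j /negPf ->; rewrite mul0r.
    rewrite -big_split; apply: eq_bigr => j _ /=.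
    by rewrite !mxE (eq_sym j i); ring.
  have lem : \sum_i \sum_j (G i j)%:R * u i ^+ 2 <= \sum_i m * u i ^+ 2.
    apply: ler_sum => i _; rewrite -mulr_suml adj_row_sum.
    by rewrite ler_wpM2r ?sqr_ge0.
  have sw : \sum_i \sum_j (G i j)%:R * u j ^+ 2 =
      \sum_i \sum_j (G i j)%:R * u i ^+ 2.
    rewrite exchange_big; apply: eq_bigr => i _; apply: eq_bigr => j _ /=.
    by rewrite edge_sym.
  (* This is twice the form of the signless Laplacian, which [Y] dominates because all degrees are
     at most [m]. *)
  have : 0 <= \sum_i \sum_j (G i j)%:R * (u i + u j) ^+ 2.
    by apply: sumr_ge0 => i _; apply: sumr_ge0 => j _;
      rewrite mulr_ge0 ?sqr_ge0.
  have -> : \sum_i \sum_j (G i j)%:R * (u i + u j) ^+ 2 =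
      \sum_i \sum_j (G i j)%:R * u i ^+ 2 + \sum_i \sum_j (G i j)%:R * u j ^+ 2
      + 2 * \sum_i \sum_j (G i j)%:R * (u i * u j).
    rewrite mulr_sumr -!big_split; apply: eq_bigr => i _ /=.
    rewrite mulr_sumr -!big_split; apply: eq_bigr => j _ /=; ring.
  by rewrite sw; lra.
have [m0|mn0] := eqVneq m 0.
  have -> : d = 0.
    rewrite /avgdeg big1 ?mul0r // => i _; apply/eqP.
    by rewrite -leqn0 -(ler_nat R) (le_trans (degm i)) // m0.
  by rewrite m0 !mul0r.
have m_gt0 : 0 < m by rewrite lt_neqAle eq_sym mn0.
have /(disc_le_pdisc G) : pdisc_feasible (m^-1 *: Y).
  split; first by apply: psdmxZ => //; rewrite invr_ge0.
  by move=> i; rewrite !mxE edge_irr eqxx add0r mulr1 mulVf.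
by rewrite /disc mxinnerZl dY mulrC ler_pdivrMr // [_ * m]mulrC.
Qed.

(* Test matrix: the entrywise square of N = D - B, restricted to the indices
   with N_ii <= K; T is the number of the other indices. *)
Lemma pdisc_ge_cubes (K : R) : (0 < n)%N -> 0 < K -> d <= n%:R ->
  exists2 T : R, T * K <= pdisc R G + d &
    (1 - q) ^+ 3 * (n%:R * d - 2 * (maxdeg G)%:R * T)
      - q ^+ 3 * (n%:R ^+ 2 - n%:R * d) - K ^+ 2 * d
    <= K ^+ 2 * pdisc R G.
Proof.
move=> n0 K0 dn; have nz : n%:R != 0 :> R by rewrite pnatr_eq0 -lt0n.
have q0 : 0 <= q by rewrite divr_ge0 // avgdeg_ge0.
have q1 : q <= 1 by rewrite ler_pdivrMr ?ltr0n // mul1r.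
have [D sumD pN] := pdisc_dual R G.
set B := _ - _ in pN; set N := \matrix_(_, _) _ in pN.
have BE i j : B i j = (G i j)%:R - q by rewrite !mxE mulr1.
have NE i j : N i j = (i == j)%:R * D i - B i j by rewrite mxE.
have Nd i : N i i = D i + q by rewrite NE BE eqxx edge_irr /=; ring.
have Nd0 i : 0 <= N i i by exact: psdmx_diag_ge0.
pose x i : R := (N i i <= K)%R%:R.
have x01 i : 0 <= x i <= 1 by rewrite /x; case: (N i i <= K); rewrite /= lexx ler01.
exists (\sum_i (1 - x i)).
  (* Markov's inequality: the nonnegative diagonal of [N] sums to [p + d], and each discarded entry
     exceeds [K]. *)
  rewrite -sumD mulr_suml.
  have -> : d = \sum_(i < n) q.
    by rewrite sumr_const card_ord -[q *+ n]mulr_natr divfK.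
  rewrite -big_split /=; apply: ler_sum => i _; rewrite -Nd /x.
  case: (leP (N i i) K) => [_|/ltW NK] /=; first by rewrite subrr mul0r.
  by rewrite subr0 mul1r.
pose Y := K ^- 2 *: \matrix_(i, j)
  (x i * x j * (\matrix_(i, j) (N i j * N i j)) i j).
have fY : pdisc_feasible Y.
  split.
    apply: psdmxZ; first by rewrite invr_ge0 exprn_ge0 // ltW.
    exact/psdmx_congr_diag/psdmx_schur_product.
  move=> i.
  have -> : Y i i = K ^- 2 * (x i * x i * (N i i * N i i)) by rewrite !mxE.
  rewrite mulrC ler_pdivrMr ?exprn_gt0 // mul1r /x.
  case: (leP (N i i) K) => [NK|_]; last by rewrite !mul0r exprn_ge0 // ltW.
  by rewrite !mul1r -expr2 lerXn2r // nnegrE ?(ltW K0).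
have := disc_le_pdisc G fY; rewrite /disc mxinnerZl -/B mulrC.
rewrite ler_pdivrMr ?exprn_gt0 // [_ * K ^+ 2]mulrC; apply: le_trans.
(* [Z] is an entrywise lower bound. Off the diagonal the term is [x_i x_j B_ij^3]: on edges
   [x_i x_j >= 1 - (1 - x_i) - (1 - x_j)], on non-edges [x_i x_j <= 1]. A diagonal term is at least
   [- K^2 q]. *)
pose Z i j : R := (1 - q) ^+ 3 * ((G i j)%:R - (G i j)%:R * (1 - x i)
    - (G i j)%:R * (1 - x j)) - q ^+ 3 * (1 - (G i j)%:R)
    - (j == i)%:R * (K ^+ 2 * q).
apply: (@le_trans _ _ (\sum_i \sum_j Z i j)); last first.
  apply: ler_sum => i _; apply: ler_sum => j _.
  have -> : (\matrix_(i, j) (x i * x j * (\matrix_(i, j) (N i j * N i j)) i j))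
      i j = x i * x j * (N i j * N i j) by rewrite !mxE.
  rewrite /Z (eq_sym j i); have [<-|ij] := eqVneq i j.
    rewrite edge_irr BE edge_irr /= -expr2 /x; have := Nd0 i.
    have q3 : 0 <= q ^+ 3 by rewrite exprn_ge0.
    have Kq : 0 <= K ^+ 2 * q by rewrite mulr_ge0 // exprn_ge0 // ltW.
    case: (leP (N i i) K) => [NK N0|_ _] /=; last by lra.
    have : N i i ^+ 2 * q <= K ^+ 2 * q.
      by rewrite ler_wpM2r // lerXn2r // nnegrE ?(ltW K0).
    by lra.
  have -> : N i j = - B i j by rewrite NE (negPf ij) mul0r sub0r.
  have c3 : 0 <= (1 - q) ^+ 3 by rewrite exprn_ge0 // subr_ge0.
  have q3 : 0 <= q ^+ 3 by rewrite exprn_ge0.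
  have xx0 : 0 <= (1 - x i) * (1 - x j).
    by case/andP: (x01 i) => ? ?; case/andP: (x01 j) => ? ?;
      rewrite mulr_ge0 ?subr_ge0.
  have xx1 : x i * x j <= 1.
    by case/andP: (x01 i) => ? ?; case/andP: (x01 j) => ? ?; rewrite mulr_ile1.
  rewrite BE mulrNN; case: (G i j) => /=.
    have := mulr_ge0 c3 xx0; lra.
  have : 0 <= q ^+ 3 * (1 - x i * x j) by rewrite mulr_ge0 // subr_ge0.
  lra.
have rowZ i : \sum_j Z i j = (1 - q) ^+ 3 * ((deg G i)%:R
    - (deg G i)%:R * (1 - x i) - \sum_j (G i j)%:R * (1 - x j))
    - q ^+ 3 * (n%:R - (deg G i)%:R) - K ^+ 2 * q.
  have -> : n%:R - (deg G i)%:R = \sum_j (1 - (G i j)%:R) :> R.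
    by rewrite sumrB sumr_const card_ord adj_row_sum.
  have -> : K ^+ 2 * q = \sum_j (j == i)%:R * (K ^+ 2 * q).
    by rewrite (bigD1 i) //= eqxx mul1r big1 ?addr0 // => j /negPf ->;
      rewrite mul0r.
  by rewrite -adj_row_sum mulr_suml -!sumrB !mulr_sumr -!sumrB.
have sw : \sum_i \sum_j (G i j)%:R * (1 - x j) =
    \sum_i (deg G i)%:R * (1 - x i).
  rewrite exchange_big; apply: eq_bigr => j _ /=.
  rewrite -mulr_suml -adj_row_sum; congr (_ * _).
  by apply: eq_bigr => i _; rewrite edge_sym.
set T := \sum_i (1 - x i).
rewrite (eq_bigr _ (fun i _ => rowZ i)) !sumrB -!mulr_sumr !sumrB sw.
rewrite sum_deg // !sumr_const card_ord -[n%:R *+ n]mulr_natr.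
rewrite -[n%:R^-1 *+ n]mulr_natr mulVf // mulr1.
rewrite !lerD2r ler_wpM2l ?exprn_ge0 ?subr_ge0 //.
(* Each discarded index loses at most [maxdeg G] edge entries in its row and as many in its
   column. *)
have : \sum_i (deg G i)%:R * (1 - x i) <= (maxdeg G)%:R * T.
  rewrite /T mulr_sumr; apply: ler_sum => i _; rewrite ler_wpM2r //.
    by rewrite subr_ge0; case/andP: (x01 i).
  by rewrite ler_nat deg_le_maxdeg.
by lra.
Qed.

End Graph.

(** * Choice of the threshold and combination of the bounds *)

Lemma pdisc_cubic_bound (R : realType) (eps : R) n (G : sgraph n) :
  (0 < n)%N -> 0 < eps -> eps <= 1 / 2 ->
  (maxdeg G)%:R <= avgdeg R G * (1 + eps / 2) ->
  avgdeg R G <= n%:R * (1 / 2 - eps) -> 0 < avgdeg R G ->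
  3 * eps ^+ 3 * n%:R ^+ 3 * avgdeg R G
    <= 400 * (pdisc R G + avgdeg R G) ^+ 3.
Proof.
move=> n0 e0 e1 hm hd d0.
have n_gt0 : 0 < n%:R :> R by rewrite ltr0n.
have p0 := pdisc_ge0 (R := R) G.
set p := pdisc R G in p0 *; set d := avgdeg R G in hm hd d0 *.
set s := p + d; have s0 : 0 < s by rewrite ltr_wpDl.
(* With this threshold at most eps n / 10 indices are discarded. *)
set K := 10 * s / (eps * n%:R).
have en0 : 0 < eps * n%:R by rewrite mulr_gt0.
have K0 : 0 < K by rewrite divr_gt0 // mulr_gt0.
have dn : d <= n%:R by nra.
have [T] := pdisc_ge_cubes n0 K0 dn.
rewrite -/p -/d -/s; set q := d / n%:R.
have dE : d = n%:R * q by rewrite mulrC divfK // gt_eqF.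
have q0 : 0 <= q by rewrite divr_ge0 // ltW.
have q1 : q <= 1 / 2 - eps by rewrite ler_pdivrMr // mulrC.
have TE : T * K <= s -> 10 * T <= eps * n%:R.
  rewrite /K mulrA ler_pdivrMr // => h.
  have : s * (10 * T) <= s * (eps * n%:R) by lra.
  by rewrite ler_pM2l.
move=> /TE {}TE main.
(* Here [maxdeg G <= 5 d / 4] and [T <= eps n / 10]. Only an upper bound on [T] is at hand, hence
   the split on its sign. *)
have mT : 2 * (maxdeg G)%:R * T <= n%:R * d * eps / 4.
  have [T0|/ltW T0] := leP T 0.
    have : 2 * (maxdeg G)%:R * T <= 0 by rewrite mulr_ge0_le0 // mulr_ge0.
    have : 0 <= n%:R * d * eps / 4 by rewrite !mulr_ge0 ?invr_ge0 // ltW.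
    by lra.
  have h1 : (maxdeg G)%:R * T <= (5 / 4 * d) * T.
    by rewrite ler_wpM2r //; nra.
  have h2 : d * (10 * T) <= d * (eps * n%:R) by rewrite ler_wpM2l // ltW.
  by lra.
have c1 : (1 - q) ^+ 3 * (2 * (maxdeg G)%:R * T) <= n%:R * d * eps / 4.
  have [T0|/ltW T0] := leP (2 * (maxdeg G)%:R * T) 0.
    have : (1 - q) ^+ 3 * (2 * (maxdeg G)%:R * T) <= 0.
      by rewrite mulr_ge0_le0 // exprn_ge0 //; lra.
    have : 0 <= n%:R * d * eps / 4 by rewrite !mulr_ge0 ?invr_ge0 // ltW.
    by lra.
  apply: le_trans mT; rewrite ler_piMl // exprn_ile1 //; lra.
(* From [q <= 1/2 - eps]: [1 - q >= 1/2] and [1 - 2 q >= 2 eps]. *)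
have c2 : eps * (n%:R * d) <= (1 - q) * (1 - 2 * q) * (n%:R * d).
  rewrite ler_wpM2r ?mulr_ge0 ?(ltW n_gt0) ?(ltW d0) //; nra.
have c3 : (1 - q) ^+ 3 * (n%:R * d) - q ^+ 3 * (n%:R ^+ 2 - n%:R * d) =
    (1 - q) * (1 - 2 * q) * (n%:R * d) by rewrite dE; ring.
have fin : 3 / 4 * (eps * (n%:R * d)) <= K ^+ 2 * s.
  by rewrite /s; lra.
have KE : K * (eps * n%:R) = 10 * s by rewrite divfK // gt_eqF.
have : (eps * n%:R) ^+ 2 * (3 / 4 * (eps * (n%:R * d)))
    <= (eps * n%:R) ^+ 2 * (K ^+ 2 * s) by rewrite ler_pM2l // exprn_gt0.
have -> : (eps * n%:R) ^+ 2 * (K ^+ 2 * s) = (K * (eps * n%:R)) ^+ 2 * s by ring.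
by rewrite KE; lra.
Qed.

Theorem theorem6p1 (R : realType) (eps : R) (eps_gt0 : 0 < eps) :
  exists2 c : R, 0 < c &
    forall (n : nat) (G : sgraph n),
      (maxdeg G)%:R <= avgdeg R G * (1 + eps / 2) ->
      avgdeg R G <= n%:R * (1 / 2 - eps) ->
      pdisc R G >= c * avgdeg R G `^ (1 / 4) * n%:R.
Proof.
(* The final estimate is [p^3 >= (3/400) eps^6 n^3 d], and [1/6^3 <= 3/400]. *)
exists (eps ^+ 2 / 6); first by rewrite divr_gt0 // exprn_gt0.
move=> n G hm hd; have p0 := pdisc_ge0 (R := R) G.
(* This case includes [n = 0]; otherwise [d > 0] forces [eps < 1/2]. *)
have [d0|dn0] := eqVneq (avgdeg R G) 0.
  by rewrite d0 powR0 ?mulr0 ?mul0r.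
have d_gt0 : 0 < avgdeg R G by rewrite lt_neqAle eq_sym dn0 avgdeg_ge0.
have n0 : (0 < n)%N.
  by rewrite lt0n; apply: contraNneq dn0 => n0; rewrite /avgdeg [in X in _ / X]n0 invr0 mulr0.
have n_gt0 : 0 < n%:R :> R by rewrite ltr0n.
have e1 : eps <= 1 / 2.
  have : 0 < n%:R * (1 / 2 - eps) by exact: lt_le_trans hd.
  by rewrite pmulr_rgt0 // subr_gt0 => /ltW.
have lin := pdisc_ge_maxdeg (R := R) G n0.
have cub := pdisc_cubic_bound n0 eps_gt0 e1 hm hd d_gt0.
set t := avgdeg R G `^ (1 / 4).
have t0 : 0 <= t by exact: powR_ge0.
have t4 : t ^+ 4 = avgdeg R G.
  rewrite /t -powR_mulrn ?powR_ge0 // -powRrM.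
  by rewrite [X in _ `^ X](_ : _ = 1) ?powRr1 ?avgdeg_ge0 //; field.
move: lin cub t4; set p := pdisc R G in p0 *.
set d := avgdeg R G in hm hd dn0 d_gt0 *; set m := (maxdeg G)%:R in hm *.
move=> lin cub t4.
have pn : eps * n%:R <= p.
  (* Indeed [d + m <= d (2 + eps/2) <= n (1/2 - eps)(2 + eps/2) <= n (1 - 7 eps / 4)]. *)
  have h1 : 7 / 4 * (eps * n%:R) <= n%:R - d - m by nra.
  have h2 : m * p <= 5 / 4 * d * p by rewrite ler_wpM2r //; nra.
  have : d * (7 / 4 * (eps * n%:R)) <= d * (n%:R - d - m).
    by rewrite ler_wpM2l // ltW.
  move=> h3; have : d * (7 / 4 * (eps * n%:R)) <= d * (5 / 4 * p) by lra.
  rewrite ler_pM2l //; have := mulr_gt0 eps_gt0 n_gt0; lra.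
have [t1|t1] := leP t 1.
  apply: le_trans pn; rewrite ler_wpM2r ?(ltW n_gt0) //.
  have : eps ^+ 2 / 6 * t <= eps ^+ 2 / 6 by rewrite ler_piMr // divr_ge0 ?sqr_ge0.
  by nra.
(* Both [eps p] and [eps d] are at most [p / 2], by [eps <= 1/2], [d <= n / 2] and [pn]. *)
have pd : eps * (p + d) <= p.
  have : eps * p <= 1 / 2 * p by rewrite ler_wpM2r.
  have : eps * d <= eps * (n%:R * (1 / 2)).
    by rewrite ler_wpM2l ?(ltW eps_gt0) //; nra.
  by lra.
have pd3 : (eps * (p + d)) ^+ 3 <= p ^+ 3.
  by rewrite lerXn2r // nnegrE ?mulr_ge0 ?addr_ge0 ?(ltW eps_gt0) ?(ltW d_gt0).
have cub' : 3 * eps ^+ 6 * n%:R ^+ 3 * d <= 400 * p ^+ 3.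
  have : eps ^+ 3 * (3 * eps ^+ 3 * n%:R ^+ 3 * d)
      <= eps ^+ 3 * (400 * (p + d) ^+ 3) by rewrite ler_wpM2l // exprn_ge0 // ltW.
  by move: pd3; rewrite exprMn; lra.
have t34 : t ^+ 3 <= d by rewrite -t4 [leRHS]exprSr ler_peMr ?exprn_ge0 // ltW.
have w0 : 0 <= eps ^+ 6 * n%:R ^+ 3 by rewrite mulr_ge0 ?exprn_ge0 ?(ltW eps_gt0).
have wt := ler_wpM2l w0 t34.
have wt0 : 0 <= eps ^+ 6 * n%:R ^+ 3 * t ^+ 3 by rewrite mulr_ge0 // exprn_ge0.
rewrite -(@ler_pXn2r _ 3) ?nnegrE //; last first.
  by rewrite !mulr_ge0 ?invr_ge0 ?sqr_ge0 ?(ltW eps_gt0).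
have -> : (eps ^+ 2 / 6 * t * n%:R) ^+ 3
    = (eps ^+ 6 * n%:R ^+ 3 * t ^+ 3) / 216 by field.
by lra.
Qed.
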